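(* Let $f(X):=h(\mathcal{A}(X)-b)$ for $X\in\mathbb{R}^{n\times m}$, where $h:\mathbb{R}^p\to\mathbb{R}$ is an $L_h$-smooth function, $\mathcal{A}:\mathbb{R}^{n\times m}\to\mathbb{R}^p$ is the (nonzero, linear) sampling operator, and $b=\mathcal{A}(M^* )+\omega$ for a matrix $M^*\in\mathbb{R}^{n\times m}$ and a noise vector $\omega\in\mathbb{R}^p$. For $\lambda>0$ let $$F_\lambda(U,V)=f(UV^{\mathbb{T}})+\frac{\lambda}{2}\big(\|U\|_F^2+\|V\|_F^2\big),\qquad (U,V)\in\mathbb{R}^{n\times r}\times\mathbb{R}^{m\times r}.$$ Then, for any nonzero $(\overline{U},\overline{V})\in\mathrm{crit}\,F_\lambda$, $$\|\overline{U}\,\overline{V}^{\mathbb{T}}-M^*\|_F\ \ge\ \max\Big(0,\ \frac{\lambda-\|\mathcal{A}^*\nabla h(-\omega)\|}{L_h\|\mathcal{A}\|^2}\Big).$$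
   Context: $h$ is $L_h$-smooth ($L_h>0$) means $h$ is differentiable and $\nabla h$ is Lipschitz continuous with modulus $L_h$. $\mathrm{crit}\,F_\lambda$ is the set of points where $\nabla F_\lambda=0$. $\mathcal{A}^*$ is the adjoint of $\mathcal{A}$ with respect to the trace inner product on $\mathbb{R}^{n\times m}$ and the Euclidean inner product on $\mathbb{R}^p$; $\|\mathcal{A}\|$ is the operator norm of $\mathcal{A}$ from $(\mathbb{R}^{n\times m},\|\cdot\|_F)$ to Euclidean $\mathbb{R}^p$; $\|\cdot\|$ of a matrix is the spectral norm. *)

(* Defs.v *)
From HB Require Import structures.
From mathcomp Require Import all_boot all_order all_algebra.
From mathcomp Require Import all_classical all_reals all_analysis.

Set Implicit Arguments.
Unset Strict Implicit.
Unset Printing Implicit Defensive.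

Import Order.TTheory GRing.Theory Num.Theory.
Import numFieldNormedType.Exports.

Local Open Scope classical_set_scope.
Local Open Scope ring_scope.

(* R^p is 'cV[R]_p = 'M[R]_(p, 1); there mxdot and frob are the Euclidean
   inner product and norm. The library norm `|X| on matrices is the max-entry
   norm; it is used below only through the topology, for differentiability. *)
Definition mxdot (R : realType) (a b : nat) (X Y : 'M[R]_(a, b)) : R :=
  \tr (X^T *m Y).

Definition frob (R : realType) (a b : nat) (X : 'M[R]_(a, b)) : R :=
  Num.sqrt (mxdot X X).

(* For linear g the set below is nonempty and bounded, so the sup is genuine. *)
Definition opnorm (R : realType) (a b c d : nat)
    (g : 'M[R]_(a, b) -> 'M[R]_(c, d)) : R :=
  sup [set frob (g X) | X in [set X | frob X <= 1]].

Definition spectral_norm (R : realType) (a b : nat) (G : 'M[R]_(a, b)) : R :=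
  opnorm (fun x : 'cV[R]_b => G *m x).

(* Characterized by [mxdot_adjoint]. *)
Definition adjoint (R : realType) (n m p : nat)
    (A : {linear 'M[R]_(n, m) -> 'cV[R]_p}) (y : 'cV[R]_p) : 'M[R]_(n, m) :=
  \matrix_(i, j) mxdot (A (delta_mx i j)) y.

(* Gradients for the trace inner product (on a pair space, the sum of the two
   trace inner products); see [diff_grad] and [diff_grad2]. 'd is meaningful
   only at points of differentiability, which is every point for F_reg (loss
   h A b) lambda as soon as h is differentiable. *)
Definition grad (R : realType) (a b : nat) (f : 'M[R]_(a, b) -> R)
    (X : 'M[R]_(a, b)) : 'M[R]_(a, b) :=
  \matrix_(i, j) 'd f X (delta_mx i j).

Definition grad2 (R : realType) (a b c d : nat)
    (F : 'M[R]_(a, b) * 'M[R]_(c, d) -> R) (z : 'M[R]_(a, b) * 'M[R]_(c, d)) :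
    'M[R]_(a, b) * 'M[R]_(c, d) :=
  (\matrix_(i, j) 'd F z (delta_mx i j, 0),
   \matrix_(i, j) 'd F z (0, delta_mx i j)).

Definition smooth (R : realType) (p : nat) (L : R) (h : 'cV[R]_p -> R) : Prop :=
  (forall x, differentiable h x) /\
  (forall x y, frob (grad h x - grad h y) <= L * frob (x - y)).

Definition crit (R : realType) (a b c d : nat)
    (F : 'M[R]_(a, b) * 'M[R]_(c, d) -> R) :
    set ('M[R]_(a, b) * 'M[R]_(c, d)) :=
  [set z | grad2 F z = 0].

Definition loss (R : realType) (n m p : nat) (h : 'cV[R]_p -> R)
    (A : {linear 'M[R]_(n, m) -> 'cV[R]_p}) (b : 'cV[R]_p)
    (X : 'M[R]_(n, m)) : R :=
  h (A X - b).

Definition F_reg (R : realType) (n m r : nat) (f : 'M[R]_(n, m) -> R)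
    (lambda : R) (z : 'M[R]_(n, r) * 'M[R]_(m, r)) : R :=
  f (z.1 *m z.2^T) + lambda / 2 * (frob z.1 ^+ 2 + frob z.2 ^+ 2).

Lemma mxdotE (R : realType) (a b : nat) (X Y : 'M[R]_(a, b)) :
  mxdot X Y = \sum_i \sum_j X i j * Y i j.
Proof.
rewrite /mxdot /mxtrace exchange_big /=; apply: eq_bigr => j _.
by rewrite mxE; apply: eq_bigr => i _; rewrite mxE.
Qed.

Lemma linear_mxdot (R : realType) (a b : nat)
    (g : {linear 'M[R]_(a, b) -> R}) (X : 'M[R]_(a, b)) :
  g X = mxdot (\matrix_(i, j) g (delta_mx i j)) X.
Proof.
rewrite mxdotE {1}[X]matrix_sum_delta linear_sum; apply: eq_bigr => i _.
rewrite linear_sum; apply: eq_bigr => j _.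
by rewrite linearZ mxE mulrC.
Qed.

Lemma mxdot_adjoint (R : realType) (n m p : nat)
    (A : {linear 'M[R]_(n, m) -> 'cV[R]_p}) (X : 'M[R]_(n, m)) (y : 'cV[R]_p) :
  mxdot (A X) y = mxdot X (adjoint A y).
Proof.
rewrite [RHS]mxdotE {1}[X]matrix_sum_delta linear_sum.
rewrite /mxdot raddf_sum mulmx_suml raddf_sum; apply: eq_bigr => i _.
rewrite linear_sum raddf_sum mulmx_suml raddf_sum; apply: eq_bigr => j _.
by rewrite linearZ /= linearZ /= -scalemxAl linearZ /= mxE.
Qed.

Lemma diff_grad (R : realType) (a b : nat) (f : 'M[R]_(a, b) -> R)
    (X H : 'M[R]_(a, b)) :
  'd f X H = mxdot (grad f X) H.
Proof. exact: linear_mxdot. Qed.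

Lemma diff_grad2 (R : realType) (a b c d : nat)
    (F : 'M[R]_(a, b) * 'M[R]_(c, d) -> R) (z H : 'M[R]_(a, b) * 'M[R]_(c, d)) :
  'd F z H = mxdot (grad2 F z).1 H.1 + mxdot (grad2 F z).2 H.2.
Proof.
case: H => H1 H2 /=; have -> : (H1, H2) = (H1, 0) + (0, H2).
  by congr (_, _); rewrite /= ?addr0 ?add0r.
rewrite linearD !mxdotE; congr (_ + _).
- have -> : (H1, 0) = \sum_i \sum_j H1 i j *: (delta_mx i j, 0)
      :> 'M[R]_(a, b) * 'M[R]_(c, d).
    rewrite {1}[H1]matrix_sum_delta; symmetry.
    elim/big_ind2: _ => // [x1 x2 y1 y2 -> ->|i _].
      by congr (_, _); rewrite /= addr0.
    elim/big_ind2: _ => // [x1 x2 y1 y2 -> ->|j _].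
      by congr (_, _); rewrite /= addr0.
    by congr (_, _); rewrite /= scaler0.
  rewrite linear_sum; apply: eq_bigr => i _.
  by rewrite linear_sum; apply: eq_bigr => j _; rewrite linearZ mxE mulrC.
- have -> : (0, H2) = \sum_i \sum_j H2 i j *: (0, delta_mx i j)
      :> 'M[R]_(a, b) * 'M[R]_(c, d).
    rewrite {1}[H2]matrix_sum_delta; symmetry.
    elim/big_ind2: _ => // [x1 x2 y1 y2 -> ->|i _].
      by congr (_, _); rewrite /= addr0.
    elim/big_ind2: _ => // [x1 x2 y1 y2 -> ->|j _].
      by congr (_, _); rewrite /= addr0.
    by congr (_, _); rewrite /= scaler0.
  rewrite linear_sum; apply: eq_bigr => i _.
  by rewrite linear_sum; apply: eq_bigr => j _; rewrite linearZ mxE mulrC.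
Qed.

(* Main.v *)
(** Write [G] for the gradient of the loss at [U V^T]. Testing the critical
    point equations [G V = - lambda U] and [G^T U = - lambda V] against [U] and
    [V] gives [lambda |U|^2 = lambda |V|^2 = - <U V^T, G>], so [|U| = |V| > 0].
    Split [G] as its value [G0] at [M*], where the residual is [- omega], plus
    an error [D]. By Cauchy-Schwarz [- <U, G0 V> <= ||G0|| |U|^2] and
    [- <U, D V> <= |D| |U|^2], hence [lambda <= ||G0|| + |D|]; Lipschitz
    continuity of [grad h] bounds [|D|] by [L_h ||A||^2 |U V^T - M*|]. *)
Require Import Defs.
From mathcomp Require Import all_boot all_order all_algebra.
From mathcomp Require Import all_classical all_reals all_analysis.
From mathcomp Require Import ring lra.

Set Implicit Arguments.
Unset Strict Implicit.
Unset Printing Implicit Defensive.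

Import Order.TTheory GRing.Theory Num.Theory.
Import numFieldNormedType.Exports.

Local Open Scope classical_set_scope.
Local Open Scope ring_scope.

(** * Trace inner product and Frobenius norm *)

Lemma mxdotC (R : realType) (a b : nat) (X Y : 'M[R]_(a, b)) :
  mxdot X Y = mxdot Y X.
Proof. by rewrite /mxdot -mxtrace_tr trmx_mul trmxK. Qed.

Lemma mxdotDr (R : realType) (a b : nat) (X Y Z : 'M[R]_(a, b)) :
  mxdot X (Y + Z) = mxdot X Y + mxdot X Z.
Proof. by rewrite /mxdot mulmxDr mxtraceD. Qed.

Lemma mxdotZr (R : realType) (a b : nat) (c : R) (X Y : 'M[R]_(a, b)) :
  mxdot X (c *: Y) = c * mxdot X Y.
Proof. by rewrite /mxdot -scalemxAr mxtraceZ. Qed.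

Lemma mxdotDl (R : realType) (a b : nat) (X Y Z : 'M[R]_(a, b)) :
  mxdot (X + Y) Z = mxdot X Z + mxdot Y Z.
Proof. by rewrite !(mxdotC _ Z) mxdotDr. Qed.

Lemma mxdotZl (R : realType) (a b : nat) (c : R) (X Y : 'M[R]_(a, b)) :
  mxdot (c *: X) Y = c * mxdot X Y.
Proof. by rewrite !(mxdotC _ Y) mxdotZr. Qed.

Lemma mxdot0r (R : realType) (a b : nat) (X : 'M[R]_(a, b)) : mxdot X 0 = 0.
Proof. by rewrite /mxdot mulmx0 mxtrace0. Qed.

Lemma mxdot0l (R : realType) (a b : nat) (X : 'M[R]_(a, b)) : mxdot 0 X = 0.
Proof. by rewrite mxdotC mxdot0r. Qed.

Lemma mxdot_mulmx_trmx (R : realType) (a b c : nat) (U : 'M[R]_(a, c))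
    (V : 'M[R]_(b, c)) (G : 'M[R]_(a, b)) :
  mxdot (U *m V^T) G = mxdot U (G *m V).
Proof. by rewrite /mxdot trmx_mul trmxK -mulmxA mxtrace_mulC mulmxA. Qed.

Lemma mxdotxx_ge0 (R : realType) (a b : nat) (X : 'M[R]_(a, b)) :
  0 <= mxdot X X.
Proof.
by rewrite mxdotE; apply: sumr_ge0 => i _; apply: sumr_ge0 => j _;
   rewrite -expr2 sqr_ge0.
Qed.

Lemma frob_ge0 (R : realType) (a b : nat) (X : 'M[R]_(a, b)) : 0 <= frob X.
Proof. exact: sqrtr_ge0. Qed.

Lemma frob_sqr (R : realType) (a b : nat) (X : 'M[R]_(a, b)) :
  frob X ^+ 2 = mxdot X X.
Proof. by rewrite sqr_sqrtr // mxdotxx_ge0. Qed.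

Lemma entry_le_frob (R : realType) (a b : nat) (X : 'M[R]_(a, b)) i j :
  `|X i j| <= frob X.
Proof.
rewrite -ler_sqr ?nnegrE ?frob_ge0 // frob_sqr mxdotE real_normK ?num_real //.
rewrite (bigD1 i) //= (bigD1 j) //= -expr2 -addrA lerDl addr_ge0 //.
  by apply: sumr_ge0 => k _; rewrite -expr2 sqr_ge0.
by apply: sumr_ge0 => k _; apply: sumr_ge0 => l _; rewrite -expr2 sqr_ge0.
Qed.

Lemma frob_eq0 (R : realType) (a b : nat) (X : 'M[R]_(a, b)) :
  frob X = 0 -> X = 0.
Proof.
move=> X0; apply/matrixP => i j; rewrite mxE; apply/eqP.
by rewrite -normr_le0 -X0 entry_le_frob.
Qed.

Lemma frob0 (R : realType) (a b : nat) : frob (0 : 'M[R]_(a, b)) = 0.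
Proof. by rewrite /frob mxdot0r sqrtr0. Qed.

Lemma frobZ (R : realType) (a b : nat) (c : R) (X : 'M[R]_(a, b)) :
  frob (c *: X) = `|c| * frob X.
Proof.
by rewrite /frob mxdotZl mxdotZr mulrA -expr2 sqrtrM ?sqr_ge0// sqrtr_sqr.
Qed.

Lemma frobN (R : realType) (a b : nat) (X : 'M[R]_(a, b)) :
  frob (- X) = frob X.
Proof. by rewrite -scaleN1r frobZ normrN1 mul1r. Qed.

(** Cauchy-Schwarz: for nonzero [X] and [Y], expand the nonnegative square of
    [frob Y *: X - frob X *: Y] and cancel the positive factor [frob X * frob Y]. *)
Lemma mxdot_le_frob (R : realType) (a b : nat) (X Y : 'M[R]_(a, b)) :
  mxdot X Y <= frob X * frob Y.
Proof.
have [/frob_eq0 ->|X0] := eqVneq (frob X) 0.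
  by rewrite mxdot0l frob0 mul0r.
have [/frob_eq0 ->|Y0] := eqVneq (frob Y) 0.
  by rewrite mxdot0r frob0 mulr0.
have Xp : 0 < frob X by rewrite lt_neqAle eq_sym X0 frob_ge0.
have Yp : 0 < frob Y by rewrite lt_neqAle eq_sym Y0 frob_ge0.
have := mxdotxx_ge0 (frob Y *: X + (- frob X) *: Y).
rewrite !(mxdotDl, mxdotDr, mxdotZl, mxdotZr) (mxdotC Y X) -!frob_sqr => H.
rewrite -(ler_pM2l (mulr_gt0 Xp Yp)); nra.
Qed.

Lemma frobD (R : realType) (a b : nat) (X Y : 'M[R]_(a, b)) :
  frob (X + Y) <= frob X + frob Y.
Proof.
rewrite -ler_sqr ?nnegrE ?addr_ge0 ?frob_ge0 // frob_sqr.
rewrite mxdotDl !mxdotDr (mxdotC Y X) -!frob_sqr sqrrD.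
by have := mxdot_le_frob X Y; lra.
Qed.

(** * Operator norm of a linear map and of its adjoint *)

(** The constant is crude; it serves to show that the set under the supremum in [opnorm] is bounded
    above. Expand [X] in the matrix units and bound each entry by [frob X]. *)
Lemma linear_frob_bounded (R : realType) (a b c d : nat)
    (g : {linear 'M[R]_(a, b) -> 'M[R]_(c, d)}) (X : 'M[R]_(a, b)) :
  frob (g X) <= (\sum_i \sum_j frob (g (delta_mx i j))) * frob X.
Proof.
rewrite [X in g X]matrix_sum_delta linear_sum mulr_suml.
pose le (Z : 'M[R]_(c, d)) (t : R) := frob Z <= t.
have le0 : le 0 0 by rewrite /le frob0.
have leD Z t Z' t' : le Z t -> le Z' t' -> le (Z + Z') (t + t').
  by move=> h h'; apply: le_trans (frobD _ _) (lerD h h').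
apply: (big_ind2 le) => // i _; rewrite linear_sum mulr_suml.
apply: (big_ind2 le) => // j _; rewrite /le linearZ frobZ mulrC.
by apply: ler_wpM2l (entry_le_frob _ _ _); exact: frob_ge0.
Qed.

Lemma le_opnorm_unit (R : realType) (a b c d : nat)
    (g : {linear 'M[R]_(a, b) -> 'M[R]_(c, d)}) (X : 'M[R]_(a, b)) :
  frob X <= 1 -> frob (g X) <= opnorm g.
Proof.
move=> X1; apply: ub_le_sup; last by exists X.
exists (\sum_i \sum_j frob (g (delta_mx i j))) => _ [Y Y1 <-].
apply: le_trans (linear_frob_bounded _ _) _.
rewrite -[leRHS]mulr1; apply: ler_wpM2l => //.
by apply: sumr_ge0 => i _; apply: sumr_ge0 => j _; exact: frob_ge0.
Qed.

Lemma opnorm_ge0 (R : realType) (a b c d : nat)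
    (g : {linear 'M[R]_(a, b) -> 'M[R]_(c, d)}) : 0 <= opnorm g.
Proof.
apply: (le_trans (frob_ge0 (g 0))); apply: le_opnorm_unit.
by rewrite frob0 ler01.
Qed.

Lemma le_opnorm (R : realType) (a b c d : nat)
    (g : {linear 'M[R]_(a, b) -> 'M[R]_(c, d)}) (X : 'M[R]_(a, b)) :
  frob (g X) <= opnorm g * frob X.
Proof.
have [/frob_eq0 ->|X0] := eqVneq (frob X) 0.
  by rewrite linear0 !frob0 mulr0.
have Xp : 0 < frob X by rewrite lt_neqAle eq_sym X0 frob_ge0.
rewrite -ler_pdivrMr //.
have -> : frob (g X) / frob X = frob (g ((frob X)^-1 *: X)).
  by rewrite linearZ frobZ mulrC ger0_norm // invr_ge0 ltW.
apply: le_opnorm_unit.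
by rewrite frobZ ger0_norm ?mulVf ?lexx // invr_ge0 ltW.
Qed.

Lemma opnorm_gt0 (R : realType) (a b c d : nat)
    (g : {linear 'M[R]_(a, b) -> 'M[R]_(c, d)}) :
  (exists X, g X != 0) -> 0 < opnorm g.
Proof.
move=> [X gX]; rewrite lt_neqAle opnorm_ge0 andbT eq_sym.
apply: contraNneq gX => g0; apply/eqP/frob_eq0/eqP.
by rewrite eq_le frob_ge0 andbT; move: (le_opnorm g X); rewrite g0 mul0r.
Qed.

(** Pairing [adjoint A y] with itself moves [A] to the other side: the square of its norm is the
    inner product of [A (adjoint A y)] with [y]. Cauchy-Schwarz and one cancellation finish. *)
Lemma frob_adjoint_le (R : realType) (n m p : nat)
    (A : {linear 'M[R]_(n, m) -> 'cV[R]_p}) (y : 'cV[R]_p) :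
  frob (adjoint A y) <= opnorm A * frob y.
Proof.
have := frob_ge0 (adjoint A y); rewrite le_eqVlt => /orP[/eqP <-|yp].
  by rewrite mulr_ge0 ?opnorm_ge0 ?frob_ge0.
rewrite -(ler_pM2l yp) -expr2 frob_sqr -mxdot_adjoint.
apply: le_trans (mxdot_le_frob _ _) _.
by rewrite mulrA ler_wpM2r ?frob_ge0 // mulrC le_opnorm.
Qed.

(** * Frobenius norm of a matrix product *)

Lemma frob_sqr_col (R : realType) (a b : nat) (X : 'M[R]_(a, b)) :
  frob X ^+ 2 = \sum_j frob (col j X) ^+ 2.
Proof.
rewrite frob_sqr mxdotE exchange_big; apply: eq_bigr => j _.
rewrite frob_sqr mxdotE; apply: eq_bigr => i _.
by rewrite big_ord1 !mxE.
Qed.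

(** The columns of [G *m V] are the images under [G] of those of [V], so the operator bound applies
    column by column. *)
Lemma frob_mulmx_le_spectral (R : realType) (a b c : nat)
    (G : 'M[R]_(a, b)) (V : 'M[R]_(b, c)) :
  frob (G *m V) <= spectral_norm G * frob V.
Proof.
have s0 : 0 <= spectral_norm G by exact: (opnorm_ge0 (mulmx G)).
rewrite -ler_sqr ?nnegrE ?mulr_ge0 ?frob_ge0 // exprMn !frob_sqr_col mulr_sumr.
apply: ler_sum => j _.
rewrite -exprMn ler_sqr ?nnegrE ?mulr_ge0 ?frob_ge0 //.
by rewrite colE -mulmxA -colE; exact: (le_opnorm (mulmx G)).
Qed.

(** Each entry of the product pairs a row of [G] with a column of [V]; apply Cauchy-Schwarz to it
    and sum the squares. *)
Lemma frob_mulmx (R : realType) (a b c : nat)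
    (G : 'M[R]_(a, b)) (V : 'M[R]_(b, c)) :
  frob (G *m V) <= frob G * frob V.
Proof.
rewrite -ler_sqr ?nnegrE ?mulr_ge0 ?frob_ge0 // exprMn 2!frob_sqr.
have -> : mxdot (G *m V) (G *m V) = \sum_i \sum_j
  mxdot (row i G)^T (col j V) ^+ 2.
  rewrite mxdotE; apply: eq_bigr => i _; apply: eq_bigr => j _.
  rewrite -expr2; congr (_ ^+ 2); rewrite mxE mxdotE; apply: eq_bigr => k _.
  by rewrite big_ord1 !mxE.
rewrite mxdotE mulr_suml; apply: ler_sum => i _.
rewrite frob_sqr_col mulr_sumr; apply: ler_sum => j _.
have -> : \sum_j0 G i j0 * G i j0 = frob (row i G)^T ^+ 2.
  by rewrite frob_sqr mxdotE; apply: eq_bigr => k _; rewrite big_ord1 !mxE.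
rewrite -exprMn -ler_sqrt ?sqr_ge0// !sqrtr_sqr.
rewrite [leRHS]ger0_norm ?mulr_ge0 ?frob_ge0 //.
(* The absolute value needs both signs; the lower bound is Cauchy-Schwarz for the negated row. *)
rewrite ler_norml mxdot_le_frob andbT lerNl -mulN1r -mxdotZl scaleN1r.
by apply: le_trans (mxdot_le_frob _ _) _; rewrite frobN.
Qed.

(** * Differentiability of the regularized objective *)

Lemma differentiable_sum_fun (R : realType) (V W : normedModType R) (k : nat)
    (f : 'I_k -> V -> W) (x : V) :
  (forall i, differentiable (f i) x) ->
  differentiable (fun y => \sum_i f i y) x.
Proof.
move=> df; rewrite (_ : (fun _ => _) = \sum_i f i).
  exact: differentiable_sum.
by apply/funext => y; rewrite fct_sumE.
Qed.

Lemma differentiable_linear_mx (R : realType) (a b : nat) (W : normedModType R)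
    (g : {linear 'M[R]_(a, b) -> W}) (X : 'M[R]_(a, b)) :
  differentiable g X.
Proof.
rewrite (_ : (g : _ -> _) =
  fun X : 'M[R]_(a, b) => \sum_i \sum_j X i j *: g (delta_mx i j)).
  apply: differentiable_sum_fun => i; apply: differentiable_sum_fun => j.
  by apply: differentiableZl; exact: differentiable_coord.
apply/funext => Y; rewrite {1}[Y]matrix_sum_delta linear_sum.
apply: eq_bigr => i _; rewrite linear_sum.
by apply: eq_bigr => j _; rewrite linearZ.
Qed.

Lemma differentiable_entrywise (R : realType) (V : normedModType R) (a b : nat)
    (f : V -> 'M[R]_(a, b)) (x : V) :
  (forall i j, differentiable (fun y => f y i j) x) -> differentiable f x.
Proof.
move=> df; rewrite (_ : f = fun y => \sum_i \sum_j f y i j *: delta_mx i j).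
  apply: differentiable_sum_fun => i; apply: differentiable_sum_fun => j.
  exact: differentiableZl.
by apply/funext => y; exact: matrix_sum_delta.
Qed.

Lemma differentiable_fst_entry (R : realType) (a b c d : nat) i j
    (z : 'M[R]_(a, b) * 'M[R]_(c, d)) :
  differentiable (fun z : 'M[R]_(a, b) * 'M[R]_(c, d) => z.1 i j) z.
Proof.
apply: (@differentiable_comp _ _ _ _ fst (fun X : 'M[R]_(a, b) => X i j)).
  by apply: linear_differentiable => ?; exact: cvg_fst.
exact: differentiable_coord.
Qed.

Lemma differentiable_snd_entry (R : realType) (a b c d : nat) i j
    (z : 'M[R]_(a, b) * 'M[R]_(c, d)) :
  differentiable (fun z : 'M[R]_(a, b) * 'M[R]_(c, d) => z.2 i j) z.
Proof.
apply: (@differentiable_comp _ _ _ _ snd (fun X : 'M[R]_(c, d) => X i j)).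
  by apply: linear_differentiable => ?; exact: cvg_snd.
exact: differentiable_coord.
Qed.

(** This makes the differential of [F_reg] meaningful and lets it be computed as a directional
    derivative. Apart from [h], everything is polynomial in the entries of [U] and [V]. *)
Lemma differentiable_F_reg (R : realType) (n m p r : nat) (h : 'cV[R]_p -> R)
    (A : {linear 'M[R]_(n, m) -> 'cV[R]_p}) (b : 'cV[R]_p) (lambda : R)
    (z : 'M[R]_(n, r) * 'M[R]_(m, r)) :
  (forall x, differentiable h x) ->
  differentiable (F_reg (loss h A b) lambda) z.
Proof.
move=> dh.
apply: differentiableD.
  apply: (@differentiable_comp _ _ _ _ (fun z : 'M[R]_(n, r) * 'M[R]_(m, r) =>
            z.1 *m z.2^T) (loss h A b)).
    apply: differentiable_entrywise => i j.
    rewrite (_ : (fun _ => _) = fun z : 'M[R]_(n, r) * 'M[R]_(m, r) =>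
      \sum_k z.1 i k * z.2 j k).
      apply: differentiable_sum_fun => k.
      apply: differentiableM; first exact: differentiable_fst_entry.
      exact: differentiable_snd_entry.
    by apply/funext => y; rewrite mxE; apply: eq_bigr => k _; rewrite mxE.
  apply: (@differentiable_comp _ _ _ _ (fun X => A X - b) h); last exact: dh.
  apply: differentiableB; first exact: differentiable_linear_mx.
  exact: differentiable_cst.
apply: differentiableZ.
apply: differentiableD.
  rewrite (_ : (fun _ => _) = fun z : 'M[R]_(n, r) * 'M[R]_(m, r) =>
      \sum_i \sum_j z.1 i j * z.1 i j).
    apply: differentiable_sum_fun => i; apply: differentiable_sum_fun => j.
    by apply: differentiableM; exact: differentiable_fst_entry.
  by apply/funext => y; rewrite frob_sqr mxdotE.
rewrite (_ : (fun _ => _) = fun z : 'M[R]_(n, r) * 'M[R]_(m, r) =>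
    \sum_i \sum_j z.2 i j * z.2 i j).
  apply: differentiable_sum_fun => i; apply: differentiable_sum_fun => j.
  by apply: differentiableM; exact: differentiable_snd_entry.
by apply/funext => y; rewrite frob_sqr mxdotE.
Qed.

(** * Critical points tested against their own factors *)

(** Difference quotient of the regularizer when one factor is scaled by [1 + t]: for nonzero [t] it
    equals [c * ((2 + t) * s)]. *)
Lemma cvg_quotient_quadratic (R : realType) (c s : R) :
  (fun t : R => t^-1 * (c * (((1 + t) ^+ 2 - 1) * s))) @ 0^' --> c * (2 * s).
Proof.
have H : (fun t : R => c * ((2 + t) * s)) @ 0^' --> c * ((2 + 0) * s).
  by apply: cvgMr; apply: cvgMl; apply: cvgD;
    [exact: cvg_cst | exact: nbhs_dnbhs].
rewrite addr0 in H; apply: cvg_trans H; apply: near_eq_cvg.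
near=> t.
have t0 : t != 0 by near: t; exact: nbhs_dnbhs_neq.
by rewrite sqrrD; field.
Unshelve. all: by end_near. Qed.

(* Along [v = (U, 0)] or [v = (0, V)] at [(U, V)] the product [U V^T] is only
   rescaled, so the derivative is an ordinary limit of one-variable quotients
   and no chain rule through the product is needed. *)
Lemma diff_F_reg_homothety (R : realType) (n m p r : nat) (h : 'cV[R]_p -> R)
    (A : {linear 'M[R]_(n, m) -> 'cV[R]_p}) (b : 'cV[R]_p) (lambda s : R)
    (z v : 'M[R]_(n, r) * 'M[R]_(m, r)) :
  (forall x, differentiable h x) ->
  (forall t, (t *: v + z).1 *m (t *: v + z).2^T = (1 + t) *: (z.1 *m z.2^T)) ->
  (forall t, frob (t *: v + z).1 ^+ 2 + frob (t *: v + z).2 ^+ 2 =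
     frob z.1 ^+ 2 + frob z.2 ^+ 2 + ((1 + t) ^+ 2 - 1) * s) ->
  'd (F_reg (loss h A b) lambda) z v =
  mxdot (z.1 *m z.2^T) (adjoint A (grad h (A (z.1 *m z.2^T) - b))) + lambda * s.
Proof.
move=> dh prodE sqE; set X := z.1 *m z.2^T.
rewrite -deriveE; last exact: differentiable_F_reg.
rewrite -mxdot_adjoint mxdotC -diff_grad -deriveE; last exact: dh.
(* Scaling the product by [1 + t] moves the argument of [h] along the line through [A X - b] with
   direction [A X]. *)
have dX : derivable h (A X - b) (A X) by exact/diff_derivable/dh.
apply: cvg_lim => //=.
have -> : lambda * s = lambda / 2 * (2 * s) by field.
apply: cvg_trans (cvgD dX (@cvg_quotient_quadratic _ (lambda / 2) s)).
apply: near_eq_cvg; near=> t.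
rewrite /= /F_reg /loss prodE sqE -/X [A (_ *: X)]linearZ.
have -> : (1 + t) *: A X - b = t *: A X + (A X - b).
  by rewrite scalerDl scale1r addrA [A X + _]addrC.
rewrite fctE /GRing.scale /=; ring.
Unshelve. all: by end_near. Qed.

(** Take the direction [(U, 0)] with [s = frob U ^+ 2]; at a critical point the differential
    vanishes in every direction. *)
Lemma crit_frob_left (R : realType) (n m p r : nat) (h : 'cV[R]_p -> R)
    (A : {linear 'M[R]_(n, m) -> 'cV[R]_p}) (b : 'cV[R]_p) (lambda : R)
    (U : 'M[R]_(n, r)) (V : 'M[R]_(m, r)) :
  (forall x, differentiable h x) -> crit (F_reg (loss h A b) lambda) (U, V) ->
  mxdot (U *m V^T) (adjoint A (grad h (A (U *m V^T) - b)))
    + lambda * frob U ^+ 2 = 0.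
Proof.
move=> dh critUV.
rewrite -(@diff_F_reg_homothety _ _ _ _ _ h A b lambda _ (U, V) (U, 0)) //=.
- by rewrite diff_grad2 critUV /= !mxdot0l addr0.
- by move=> t; rewrite scaler0 add0r -{2}[U]scale1r -scalerDl addrC scalemxAl.
move=> t; rewrite scaler0 add0r -{2}[U]scale1r -scalerDl frobZ exprMn.
rewrite real_normK ?num_real //; ring.
Qed.

Lemma crit_frob_right (R : realType) (n m p r : nat) (h : 'cV[R]_p -> R)
    (A : {linear 'M[R]_(n, m) -> 'cV[R]_p}) (b : 'cV[R]_p) (lambda : R)
    (U : 'M[R]_(n, r)) (V : 'M[R]_(m, r)) :
  (forall x, differentiable h x) -> crit (F_reg (loss h A b) lambda) (U, V) ->
  mxdot (U *m V^T) (adjoint A (grad h (A (U *m V^T) - b)))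
    + lambda * frob V ^+ 2 = 0.
Proof.
move=> dh critUV.
rewrite -(@diff_F_reg_homothety _ _ _ _ _ h A b lambda _ (U, V) (0, V)) //=.
- by rewrite diff_grad2 critUV /= !mxdot0l addr0.
- move=> t; rewrite scaler0 add0r -{2}[V]scale1r -scalerDl addrC.
  by rewrite linearZ /= -scalemxAr.
move=> t; rewrite scaler0 add0r -{2}[V]scale1r -scalerDl frobZ exprMn.
rewrite real_normK ?num_real //; ring.
Qed.

Theorem proposition1 (R : realType) (n m p r : nat)
    (h : 'cV[R]_p -> R) (L_h : R)
    (A : {linear 'M[R]_(n, m) -> 'cV[R]_p})
    (Mstar : 'M[R]_(n, m)) (omega b : 'cV[R]_p) (lambda : R) :
  0 < L_h -> smooth L_h h ->
  (exists X : 'M[R]_(n, m), A X != 0) ->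
  b = A Mstar + omega ->
  0 < lambda ->
  forall (U : 'M[R]_(n, r)) (V : 'M[R]_(m, r)),
    (U, V) != 0 ->
    crit (F_reg (loss h A b) lambda) (U, V) ->
    Num.max 0 ((lambda - spectral_norm (adjoint A (grad h (- omega))))
               / (L_h * opnorm A ^+ 2))
      <= frob (U *m V^T - Mstar).
Proof.
move=> L0 [dh lip] /opnorm_gt0 A0 bE lam0 U V UV0 cUV.
have eqU := crit_frob_left dh cUV; have eqV := crit_frob_right dh cUV.
move: eqU eqV; set X := U *m V^T; set y := A X - b => eqU eqV.
(* The bound by 0 is immediate; the other one is cleared of its denominator, which is positive
   because [A] is nonzero. *)
rewrite ge_max frob_ge0 /= ler_pdivrMr ?mulr_gt0 ?exprn_gt0 //.
have UVE : frob V = frob U.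
  apply/eqP; rewrite -(@eqrXn2 _ 2) ?frob_ge0 //; apply/eqP.
  by apply: (mulfI (lt0r_neq0 lam0)); lra.
have U0 : 0 < frob U.
  rewrite lt_neqAle frob_ge0 andbT eq_sym; apply: contraNneq UV0 => U0.
  by rewrite (frob_eq0 U0); move: UVE; rewrite U0 => /frob_eq0 ->.
set g0 := grad h (- omega); set D := adjoint A (grad h y - g0).
have GE : adjoint A (grad h y) = adjoint A g0 + D.
  apply/matrixP => i j; rewrite !mxE -mxdotDr; congr mxdot.
  by rewrite addrC subrK.
have frobD_le : frob D <= opnorm A * (L_h * (opnorm A * frob (X - Mstar))).
  apply: le_trans (frob_adjoint_le _ _) _; apply: ler_wpM2l; first exact: ltW.
  apply: (le_trans (lip y (- omega))); apply: ler_wpM2l; first exact: ltW.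
  (* The noise cancels: [y + omega] is [A (X - Mstar)]. *)
  rewrite opprK /y bE opprD addrA subrK -linearB; exact: le_opnorm.
(* Stated for an arbitrary constant [c] so as to serve twice: with the spectral norm for the
   gradient at [Mstar], and with the Frobenius norm for the error [D]. *)
have boundN (E : 'M[R]_(n, m)) c : frob (E *m V) <= c * frob U ->
    - mxdot X E <= c * frob U ^+ 2.
  move=> EV; rewrite mxdot_mulmx_trmx -mulN1r -mxdotZl scaleN1r.
  apply: le_trans (mxdot_le_frob _ _) _; rewrite frobN mulrC expr2 mulrA.
  by rewrite ler_wpM2r ?frob_ge0.
have b0 :
    - mxdot X (adjoint A g0) <= spectral_norm (adjoint A g0) * frob U ^+ 2.
  by apply: boundN; rewrite -UVE frob_mulmx_le_spectral.
have bD : - mxdot X D <= frob D * frob U ^+ 2.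
  by apply: boundN; rewrite -UVE frob_mulmx.
have XE : mxdot X (adjoint A (grad h y)) =
    mxdot X (adjoint A g0) + mxdot X D by rewrite -mxdotDr -GE.
have key : lambda <= spectral_norm (adjoint A g0) + frob D.
  (* Multiply by [frob U ^+ 2], positive since the critical point is nonzero; the left side then
     becomes the pairing given by [eqU]. *)
  rewrite -(ler_pM2r (exprn_gt0 2 U0)) mulrDl.
  have -> : lambda * frob U ^+ 2 = - mxdot X (adjoint A g0) + - mxdot X D.
    by rewrite -opprD -XE; apply/eqP; rewrite -addr_eq0 addrC; exact/eqP.
  exact: lerD.
rewrite lerBlDl; apply: (le_trans key); rewrite lerD2l.
apply: (le_trans frobD_le).
by rewrite [leRHS]mulrC expr2 !mulrA [L_h * _]mulrC lexx.
Qed.
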